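(* Let $m,n\geq 4$ be integers with $m\neq 5$ and $n\neq 5$. Then $s_6(C_m\square C_n)=4$.
   Context: $P_k$ denotes the path on $k$ vertices, $C_k$ the cycle on $k$ vertices, and $\square$ denotes the Cartesian product of graphs. A $P_k$-coloring of a graph $G$ is a proper vertex coloring of $G$ in which no copy of $P_k$ in $G$ (as a subgraph, not necessarily induced) is bicolored, i.e. has its vertices colored using only two colors. The $P_k$-chromatic number $s_k(G)$ is the minimum number of colors in a $P_k$-coloring of $G$. *)

(* Defs.v *)
From mathcomp Require Import all_boot.

Set Implicit Arguments.
Unset Strict Implicit.
Unset Printing Implicit Defensive.

Record sgraph := SGraph {
  vertex :> finType;
  adj : rel vertex;
  adj_sym : symmetric adj;
  adj_irrefl : irreflexive adj }.

Definition path_adj (k : nat) : rel 'I_k :=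
  fun i j => (i.+1 == j :> nat) || (j.+1 == i :> nat).

Lemma path_adj_sym k : symmetric (@path_adj k).
Proof. by move=> i j; rewrite /path_adj orbC. Qed.

Lemma path_adj_irrefl k : irreflexive (@path_adj k).
Proof. by move=> i; rewrite /path_adj orbb gtn_eqF. Qed.

Definition path_graph (k : nat) : sgraph :=
  SGraph (@path_adj_sym k) (@path_adj_irrefl k).

(* [ordS i] is i + 1 modulo n.  The conjunct [i != j] only matters for n = 1;
   this is the usual n-cycle for n >= 3. *)
Definition cycle_adj (n : nat) : rel 'I_n :=
  fun i j => (i != j) && ((j == ordS i) || (i == ordS j)).

Lemma cycle_adj_sym n : symmetric (@cycle_adj n).
Proof. by move=> i j; rewrite /cycle_adj orbC eq_sym. Qed.

Lemma cycle_adj_irrefl n : irreflexive (@cycle_adj n).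
Proof. by move=> i; rewrite /cycle_adj eqxx. Qed.

Definition cycle_graph (n : nat) : sgraph :=
  SGraph (@cycle_adj_sym n) (@cycle_adj_irrefl n).

Definition box_adj (G H : sgraph) : rel (G * H)%type :=
  fun u v => ((u.1 == v.1) && adj u.2 v.2) || (adj u.1 v.1 && (u.2 == v.2)).

Lemma box_adj_sym G H : symmetric (@box_adj G H).
Proof.
move=> u v; rewrite /box_adj (eq_sym u.1) (eq_sym u.2).
by rewrite (adj_sym u.1) (adj_sym u.2).
Qed.

Lemma box_adj_irrefl G H : irreflexive (@box_adj G H).
Proof. by move=> u; rewrite /box_adj !adj_irrefl andbF. Qed.

Definition box_graph (G H : sgraph) : sgraph :=
  SGraph (@box_adj_sym G H) (@box_adj_irrefl G H).

Notation "G □ H" := (box_graph G H) (at level 40, left associativity).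

(* [p] embeds H as a subgraph of G, not necessarily induced. *)
Definition is_copy (H G : sgraph) (p : {ffun H -> G}) : bool :=
  injectiveb p && [forall x, forall y, adj x y ==> adj (p x) (p y)].

Section Coloring.

Variables (G : sgraph) (c : nat) (f : {ffun G -> 'I_c}).

Definition proper_coloring : bool :=
  [forall x, forall y, adj x y ==> (f x != f y)].

Definition bicolored (H : sgraph) (p : {ffun H -> G}) : bool :=
  #|[set f (p x) | x : H]| <= 2.

Definition path_coloring (k : nat) : bool :=
  proper_coloring &&
  [forall p : {ffun path_graph k -> G}, is_copy p ==> ~~ bicolored p].

End Coloring.

Definition path_colorable (k : nat) (G : sgraph) (c : nat) : bool :=
  [exists f : {ffun G -> 'I_c}, path_coloring f k].

(* The search is restricted to c <= #|G|.  For k >= 3 this loses nothing, since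
   giving distinct colors to all vertices is a P_k-coloring: see
   [path_chromaticP].  For k <= 2 the value may be the junk default #|G|. *)
Definition path_chromatic (k : nat) (G : sgraph) : nat :=
  [arg min_(c < (ord_max : 'I_#|G|.+1) | path_colorable k G c) (c : nat)].

Lemma path_colorable_card k (G : sgraph) : 2 < k -> path_colorable k G #|G|.
Proof.
move=> k_gt2; apply/existsP; exists [ffun x => enum_rank x].
apply/andP; split.
  apply/forallP=> x; apply/forallP=> y; apply/implyP=> xy.
  rewrite !ffunE (inj_eq enum_rank_inj); apply: contraTneq xy => ->.
  by rewrite adj_irrefl.
apply/forallP=> p; apply/implyP=> /andP[/injectiveP p_inj _].
rewrite /bicolored card_imset ?card_ord -?ltnNge //.
by move=> i j; rewrite !ffunE => /enum_rank_inj /p_inj.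
Qed.

Lemma path_chromaticP k (G : sgraph) c : 2 < k ->
  path_chromatic k G = c <->
  path_colorable k G c /\ (forall d, path_colorable k G d -> c <= d).
Proof.
move=> k_gt2; rewrite /path_chromatic.
case: arg_minnP => [|i col_i min_i]; first exact: path_colorable_card.
have min d : path_colorable k G d -> i <= d.
  move=> col_d; case: (ltnP d #|G|.+1) => [lt_d | /ltnW le_d].
    exact: (min_i (Ordinal lt_d)).
  by apply: leq_trans le_d; rewrite -ltnS.
split=> [<- // | [col_c min_c]].
by apply/eqP; rewrite eqn_leq min // min_c.
Qed.

(* Main.v *)
(* Lower bound: already the 4 x 4 grid, a subgraph of the torus, has no proper
   3-coloring without a bicolored P_6; this is a small exhaustive search.
   Upper bound: every m >= 4 other than 5 has the form 3a + 4b, so that the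
   vertices of C_m can be labelled by consecutive blocks 012 and 0123, and
   likewise those of C_n.  A vertex of the torus gets the color that a fixed
   4 x 4 Latin square assigns to its pair of labels.  Unrolling the torus, a path
   on 6 vertices lives in an 11 x 11 window around its first vertex, and only
   finitely many sequences of labels can occur along the sides of a window. *)
Require Import Defs.
From mathcomp Require Import all_boot zify.

Set Implicit Arguments.
Unset Strict Implicit.
Unset Printing Implicit Defensive.

(** * Color counts along paths given as lists *)

Definition ncolors (T : Type) (C : eqType) (f : T -> C) (p : seq T) : nat :=
  size (undup (map f p)).

Lemma eq_in_ncolors (T C : eqType) (f g : T -> C) (p : seq T) :
  {in p, f =1 g} -> ncolors f p = ncolors g p.
Proof. by move=> fg; rewrite /ncolors ((eq_in_map f g p).1 fg). Qed.

Lemma ncolors_comp (T U : Type) (C : eqType) (f : U -> C) (h : T -> U) p :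
  ncolors (f \o h) p = ncolors f (map h p).
Proof. by rewrite /ncolors map_comp. Qed.

Lemma ncolors_inj (T : Type) (C D : eqType) (h : C -> D) (f : T -> C) p :
  injective h -> ncolors (h \o f) p = ncolors f p.
Proof. by move=> h_inj; rewrite /ncolors map_comp undup_map_inj ?size_map. Qed.

(** Here [k] counts edges: [colorful f 1 1] is properness and [colorful f 5 2] excludes a bicolored
    P_6, so one argument serves both conditions. *)
Definition colorful (G : sgraph) (C : eqType) (f : G -> C) (k t : nat) : Prop :=
  forall (x : G) (s : seq G), size s = k -> path (@adj G) x s ->
    uniq (x :: s) -> t < ncolors f (x :: s).

Lemma colorful_proper (G : sgraph) c (f : {ffun G -> 'I_c}) :
  proper_coloring f <-> colorful f 1 1.
Proof.
split=> [/forallP prop_f x [|y []] //= _ /andP[xy _] _ | f11].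
  rewrite /ncolors /= inE.
  by case: eqP (implyP (forallP (prop_f x) y) xy) => //= ->; rewrite eqxx.
apply/forallP=> x; apply/forallP=> y; apply/implyP=> xy.
have := f11 x [:: y] erefl; rewrite /= xy !inE /ncolors /= inE.
have -> : x != y by apply: contraTneq xy => ->; rewrite adj_irrefl.
by move=> /(_ isT isT); case: eqP.
Qed.

Lemma card_imset_ncolors (I : finType) (C : finType) (T : Type) (f : T -> C)
    (p : I -> T) :
  #|[set f (p i) | i : I]| = ncolors f (map p (enum I)).
Proof.
rewrite /ncolors -map_comp -(card_uniqP (undup_uniq _)).
apply: eq_card => z; rewrite mem_undup; apply/imsetP/mapP.
  by case=> i _ ->; exists i; rewrite ?mem_enum.
by case=> i _ ->; exists i.
Qed.

Lemma path_coloringP (G : sgraph) c (f : {ffun G -> 'I_c}) k :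
  path_coloring f k.+1 <-> colorful f 1 1 /\ colorful f k 2.
Proof.
split=> [/andP[/colorful_proper f11 path_f] | [/colorful_proper prop_f path_f]].
  split=> // x s size_s path_s uniq_s.
  pose p : {ffun path_graph k.+1 -> G} := [ffun i : 'I_k.+1 => nth x (x :: s) i].
  have p_enum : map p (enum 'I_k.+1) = x :: s.
    apply: (@eq_from_nth _ x); first by rewrite size_map size_enum_ord /= size_s.
    move=> i; rewrite size_map size_enum_ord => lt_i.
    by rewrite (nth_map ord0) ?size_enum_ord // ffunE nth_enum_ord.
  have adj_p (i j : 'I_k.+1) : i.+1 == j :> nat -> adj (p i) (p j).
    move=> /eqP ij; rewrite !ffunE -ij; apply/(pathP x) => //.
    by rewrite size_s -ltnS ij.
  move/forallP/(_ p): path_f; rewrite /bicolored card_imset_ncolors p_enum.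
  rewrite -ltnNge; move/implyP; apply; apply/andP; split.
    apply/injectiveP=> i j /eqP; rewrite !ffunE nth_uniq /= ?size_s //.
    by move/eqP/val_inj.
  apply/forallP=> i; apply/forallP=> j; apply/implyP=> /orP[]; first exact: adj_p.
  by rewrite adj_sym; apply: adj_p.
apply/andP; split=> //.
apply/forallP=> p; apply/implyP=> /andP[/injectiveP p_inj /forallP p_adj].
rewrite /bicolored card_imset_ncolors -ltnNge.
have uniq_p : uniq (map p (enum 'I_k.+1)) by rewrite map_inj_uniq ?enum_uniq.
have size_p : size (map p (enum 'I_k.+1)) = k.+1.
  by rewrite size_map size_enum_ord.
have nth_p x (i : 'I_k.+1) : nth x (map p (enum 'I_k.+1)) i = p i.
  by rewrite (nth_map i) ?size_enum_ord // nth_ord_enum.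
case: (map p _) uniq_p size_p nth_p => // x s uniq_s [size_s] nth_p.
apply: path_f => //; apply/(pathP x) => i; rewrite size_s => lt_i.
have := nth_p x (Ordinal (ltnW lt_i : i < k.+1)) => /= ->.
have := nth_p x (Ordinal (lt_i : i.+1 < k.+1)) => /= ->.
by apply: (implyP (forallP (p_adj _) _)); apply/orP; left.
Qed.

Lemma ncolors_rev (T : Type) (C : eqType) (f : T -> C) p :
  ncolors f (rev p) = ncolors f p.
Proof.
rewrite /ncolors map_rev; apply: perm_size; apply: perm_undup => z.
exact: mem_rev.
Qed.

Lemma leq_ncolors_cons (T : Type) (C : eqType) (f : T -> C) x p :
  ncolors f p <= ncolors f (x :: p).
Proof. by rewrite /ncolors /=; case: ifP. Qed.

(** * Exhaustive enumeration of paths with pruning *)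

Section PathsFrom.

Variables (T : eqType) (nbrs : T -> seq T) (P : pred (seq T)).

(* Depth first search; the paths are listed from their last vertex on. *)
Fixpoint paths_from (k : nat) (visited : seq T) (x : T) : seq (seq T) :=
  if P (x :: visited) then
    if k is k'.+1 then flatten (map (paths_from k' (x :: visited)) (nbrs x))
    else [:: x :: visited]
  else [::].

(** Soundness of the search, used for the lower bound; the upper bound relies on completeness,
    [mem_paths_from]. *)
Lemma paths_fromP k visited x p : p \in paths_from k visited x ->
  exists s, [/\ p = catrev (x :: s) visited, size s = k, P p
              & path (fun y z => z \in nbrs y) x s].
Proof.
elim: k visited x => [|k IHk] visited x /=; case: ifP => // Px.
  by rewrite inE => /eqP->; exists [::].
case/flatten_mapP=> y xy /IHk[s [-> size_s Pp path_s]].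
by exists (y :: s); rewrite /= size_s xy.
Qed.

(** Lists grow at the head, so [P] is inherited by the initial segments of a path; this makes
    pruning by [P] lossless. *)
Hypothesis P_behead : forall x s, P (x :: s) -> P s.

Lemma mem_paths_from visited x s : P (catrev (x :: s) visited) ->
    path (fun y z => z \in nbrs y) x s ->
  catrev (x :: s) visited \in paths_from (size s) visited x.
Proof.
have P_catrev : forall t v, P (catrev t v) -> P v.
  by elim=> //= y t IHt v /IHt; apply: P_behead.
elim: s visited x => [|y s IHs] visited x /= Ps.
  by rewrite Ps inE eqxx.
case/andP=> xy path_s; rewrite (P_catrev (y :: s)) //.
by apply/flatten_mapP; exists y => //; apply: IHs.
Qed.

End PathsFrom.

(** * Coloring search on the 4 x 4 grid *)

Definition grid_nbrs (q : nat * nat) : seq (nat * nat) :=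
  [:: (q.1.+1, q.2); (q.1, q.2.+1)] ++ nseq (0 < q.1) (q.1.-1, q.2)
  ++ nseq (0 < q.2) (q.1, q.2.-1).

Lemma grid_nbrsP q r : reflect
  [\/ r = (q.1.+1, q.2), r = (q.1, q.2.+1), q = (r.1.+1, r.2) | q = (r.1, r.2.+1)]
  (r \in grid_nbrs q).
Proof.
rewrite mem_cat !inE mem_cat !mem_nseq !lt0b.
case: q r => [x y] [x' y'] /=; apply: (iffP idP).
  case/or3P => [/orP[] /eqP-> | /andP[x_gt0 /eqP[-> ->]] | /andP[y_gt0 /eqP[-> ->]]].
  - by constructor 1.
  - by constructor 2.
  - by constructor 3; rewrite prednK.
  - by constructor 4; rewrite prednK.
by case=> -[-> ->]; rewrite !eqxx ?orbT.
Qed.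

Definition in_grid (N : nat) (q : nat * nat) : bool := (q.1 < N) && (q.2 < N).

Definition grid4_paths (k : nat) : seq (seq (nat * nat)) :=
  flatten [seq paths_from grid_nbrs (fun p => all (in_grid 4) p && uniq p) k [::] (i, j)
          | i <- iota 0 4, j <- iota 0 4].

(* Cells are numbered row by row; a prefix of a coloring is the list of its
   colors. *)
Definition cell_index (q : nat * nat) : nat := q.1 * 4 + q.2.

(* [if] rather than [&&]: under call by value, [&&] would also explore the
   extensions of the prefixes that are rejected. *)
Fixpoint extendable (c : nat) (css : seq (seq (nat * seq (nat * nat))))
    (s : seq nat) : bool :=
  if css is cs :: css' then
    has (fun x => let s' := rcons s x in
           if all (fun tp => tp.1 < ncolors (fun q => nth 0 s' (cell_index q)) tp.2) cs
           then extendable c css' s' else false) (iota 0 c)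
  else true.

(** The paths whose highest-numbered cell is [i]: each path is tested as soon as all its cells are
    colored. *)
Definition constraints_at ps (i : nat) : seq (nat * seq (nat * nat)) :=
  [seq tp <- ps | let cs := map cell_index tp.2 in
                  (i \in cs) && all (fun j => j <= i) cs].

(** A coloring [h] that meets all constraints is itself a branch that the search never prunes, so a
    failed search refutes every such [h]. *)
Lemma extendable_mkseq c ps (h : nat -> nat) n k :
    (forall i, h i < c) ->
    (forall tp, tp \in ps -> tp.1 < ncolors (h \o cell_index) tp.2) ->
  extendable c [seq constraints_at ps i | i <- iota k n] (mkseq h k).
Proof.
move=> h_lt h_ps; elim: n k => //= n IHn k.
apply/hasP; exists (h k); first by rewrite mem_iota h_lt.
rewrite /= -mkseqS IHn ifT //; apply/allP=> tp.
rewrite mem_filter => /andP[/andP[_ /allP cells] /h_ps lt_tp].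
apply: leq_trans lt_tp _; apply: eq_leq; apply: eq_in_ncolors => q q_tp /=.
by rewrite nth_mkseq // ltnS cells ?map_f.
Qed.

(* One orientation of each path is enough. *)
Definition grid4_constraints : seq (nat * seq (nat * nat)) :=
  [seq tp <- [seq (1, p) | p <- grid4_paths 1] ++ [seq (2, p) | p <- grid4_paths 5]
  | cell_index (head (0, 0) tp.2) < cell_index (last (0, 0) tp.2)].

Lemma grid4_not_3_colorable :
  ~~ extendable 3 [seq constraints_at grid4_constraints i | i <- iota 0 16] [::].
Proof. by vm_compute. Qed.

Lemma cycle_adj_inord m (x : nat) : 0 < m -> x < m ->
  cycle_adj (inord x : 'I_m.+1) (inord x.+1).
Proof.
move=> m_gt0 lt_x; rewrite /cycle_adj -!val_eqE /= !inordK ?ltnS //; last exact: ltnW.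
by rewrite modn_small ?ltnS // eqxx neq_ltn ltnSn.
Qed.

(** * Lower bound: the grid inside the torus *)

Section LowerBound.

Variables m n : nat.
Hypotheses (m_ge3 : 3 <= m) (n_ge3 : 3 <= n).
Let torus := cycle_graph m.+1 □ cycle_graph n.+1.

(** Cells go to the torus vertices with the same coordinates; as both cycles have at least 4
    vertices, this is injective and keeps adjacency. *)
Lemma colorful_grid4 (C : eqType) (f : torus -> C) k t p :
    colorful f k t -> p \in grid4_paths k ->
  t < ncolors (fun q => f (inord q.1, inord q.2)) p.
Proof.
move=> f_kt; pose emb (q : nat * nat) : torus := (inord q.1, inord q.2).
case/flattenP=> ps /allpairsP[q [_ _ ->]].
case/paths_fromP=> s [def_p size_s /andP[grid_p uniq_p] path_s].
have lt4 a b : 3 <= b -> a < 4 -> a < b.+1 by move=> le3 /leq_trans; apply.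
have emb_inj : {in in_grid 4 &, injective emb}.
  move=> [a b] [a' b'] /andP[/= a4 b4] /andP[/= a4' b4'] [eq_a eq_b].
  have inord_inj N : 3 <= N -> {in gtn 4 &, injective (@inord N)}.
    move=> N_ge3 x y x4 y4 /(congr1 val) /=.
    by rewrite (inordK (lt4 x N N_ge3 x4)) (inordK (lt4 y N N_ge3 y4)).
  by rewrite (inord_inj m m_ge3 a a') // (inord_inj n n_ge3 b b').
have step a b : 3 <= b -> a.+1 < 4 -> cycle_adj (inord a : 'I_b.+1) (inord a.+1).
  by move=> b_ge3 lt_a; apply: cycle_adj_inord; apply: leq_trans b_ge3.
have emb_adj : {in in_grid 4 &, forall q r, r \in grid_nbrs q -> adj (emb q) (emb r)}.
  move=> [a b] [a' b'] /andP[/= a4 b4] /andP[/= a4' b4'] /grid_nbrsP[] [*]; subst;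
    rewrite /adj /= /box_adj /= /adj /= ?eqxx ?step ?orbT //.
  - by rewrite cycle_adj_sym step ?orbT.
  - by rewrite cycle_adj_sym step ?orbT.
have def_p' : p = rev ((q.1, q.2) :: s) by [].
rewrite def_p' all_rev in grid_p; rewrite def_p' rev_uniq in uniq_p.
rewrite def_p' ncolors_rev -[X in ncolors X]/(f \o emb) ncolors_comp.
apply: f_kt; rewrite ?size_map //.
  exact: homo_path_in emb_adj grid_p path_s.
rewrite -[_ :: _]/(map emb (_ :: s)) map_inj_in_uniq //.
by move=> r r' /(allP grid_p) ? /(allP grid_p) ?; apply: emb_inj.
Qed.

Lemma torus_not_3_colorable d : path_colorable 6 torus d -> 4 <= d.
Proof.
case/existsP=> f /path_coloringP[f11 f52]; rewrite ltnNge.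
apply/negP=> d_le3; have /negP[] := grid4_not_3_colorable.
(* The coordinates [i %/ 4] and [i %% 4] invert [cell_index] inside the grid. *)
pose h i : nat := f (inord (i %/ 4), inord (i %% 4)).
have h_cell k t p : colorful f k t -> p \in grid4_paths k ->
    t < ncolors (h \o cell_index) p.
  move=> f_kt p_k; rewrite (leq_trans (colorful_grid4 f_kt p_k)) //.
  rewrite -(ncolors_inj _ _ (@ord_inj d)); apply/eq_leq/eq_in_ncolors => q q_p.
  suff /andP[_ q2] : in_grid 4 q.
    by rewrite /= /h /cell_index divnMDl // modnMDl divn_small // modn_small // addn0.
  case/flattenP: p_k q_p => ps /allpairsP[r [_ _ ->]].
  by case/paths_fromP=> s [_ _ /andP[/allP grid_p _] _] /grid_p.
apply: (@extendable_mkseq 3 _ h 16 0) => [i | tp].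
  exact: leq_trans (ltn_ord _) d_le3.
rewrite mem_filter mem_cat => /andP[_ /orP[] /mapP[p in_p ->]] /=.
  exact: h_cell f11 in_p.
exact: h_cell f52 in_p.
Qed.

End LowerBound.

(** * Labels on a cycle and the window check *)

Definition label_step (x y : nat) : bool :=
  ((y == x.+1) && (x < 3)) || ((y == 0) && (2 <= x)).

(* The m %% 3 blocks 0123 come before the blocks 012. *)
Definition label (m i : nat) : nat :=
  if i < 4 * (m %% 3) then i %% 4 else (i - 4 * (m %% 3)) %% 3.

Lemma label_lt4 m i : label m i < 4.
Proof. by rewrite /label; case: ifP => _; lia. Qed.

(** For [m >= 4], only [m = 5] violates [4 * (m %% 3) <= m]; otherwise the blocks fill the cycle
    exactly, each ending in 2 or 3 before the next 0. *)
Lemma label_stepP m i : 4 <= m -> m <> 5 -> i < m ->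
  label_step (label m i) (label m (i.+1 %% m)).
Proof.
move=> m_ge4 m_neq5 lt_i.
have [lt_i1 | ge_i1] := ltnP i.+1 m.
  rewrite modn_small // /label_step /label; do 2!case: ifP => ?; lia.
(* The last vertex closes a block, and its successor is vertex 0, with label 0. *)
have -> : i = m.-1 by lia.
rewrite prednK ?modnn /label_step /label; last lia.
do 2!case: ifP => ?; lia.
Qed.

(** The addition table of the Klein four-group (bitwise xor on 0..3) with its rows permuted. *)
Definition table_color (x y : nat) : nat :=
  nth 0 (nth [::] [:: [:: 1; 0; 3; 2]; [:: 3; 2; 1; 0]; [:: 0; 1; 2; 3]; [:: 2; 3; 0; 1]]
             x) y.

Lemma table_color_lt4 x y : table_color x y < 4.
Proof.
by case: x => [|[|[|[|x]]]]; case: y => [|[|[|[|y]]]]; rewrite /table_color /= ?nth_nil.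
Qed.

Fixpoint label_seqs (k : nat) : seq (seq nat) :=
  if k is k'.+1 then
    [seq x :: w | w <- label_seqs k', x <- [seq x <- iota 0 4 | label_step x (head 0 w)]]
  else [seq [:: x] | x <- iota 0 4].

Lemma mem_label_seqs k w : size w = k.+1 -> all (fun x => x < 4) w ->
  sorted label_step w -> w \in label_seqs k.
Proof.
elim: k w => [|k IHk] [|x w] // [size_w] /andP[x4 w4].
  by move=> _; rewrite (size0nil size_w); apply: map_f; rewrite mem_iota.
case: w => // y w in size_w w4 *; case/andP=> xy path_w.
apply/allpairsPdep; exists (y :: w), x.
by rewrite IHk // mem_filter xy mem_iota.
Qed.

(** From the center [(k, k)], [k] steps stay in a window of side [2 * k + 1], so for words of that
    length the default of [nth] is never read. *)
Definition few_colors_paths (k t : nat) (w w' : seq nat) : seq (seq (nat * nat)) :=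
  paths_from grid_nbrs
    (fun p => uniq p && (ncolors (fun q => table_color (nth 0 w q.1) (nth 0 w' q.2)) p <= t))
    k [::] (k, k).

Definition windows_ok (k t : nat) : bool :=
  let ws := label_seqs (2 * k) in
  all (fun w => all (fun w' => nilp (few_colors_paths k t w w')) ws) ws.

Lemma windows_ok_1_1 : windows_ok 1 1. Proof. by vm_compute. Qed.
Lemma windows_ok_5_2 : windows_ok 5 2. Proof. by vm_compute. Qed.

(* [shift k i a] is the vertex i + a - k of the cycle: the a-th vertex of a
   window of 2 * k + 1 vertices centered at i. *)
Definition shift (m k : nat) (i : 'I_m.+1) (a : nat) : 'I_m.+1 :=
  inord ((i + a + k * m) %% m.+1).

Lemma val_shift m k (i : 'I_m.+1) a : shift k i a = (i + a + k * m) %% m.+1 :> nat.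
Proof. by rewrite inordK ?ltn_mod. Qed.

(** Modulo [m.+1], the summand [k * m] in [shift] stands for -k. *)
Lemma shift_center m k (i : 'I_m.+1) : shift k i k = i.
Proof.
by apply: val_inj; rewrite /= val_shift -addnA -mulnS addnC modnMDl modn_small.
Qed.

Lemma shiftS m k (i : 'I_m.+1) a : shift k i a.+1 = ordS (shift k i a).
Proof.
apply: val_inj; rewrite /= !val_shift addnS addSn -[in LHS]addn1 -[in RHS]addn1.
by rewrite modnDml.
Qed.

Lemma cycle_adj_shift m k (i j : 'I_m.+1) a :
  0 < a -> cycle_adj (shift k i a) j -> j = shift k i a.+1 \/ j = shift k i a.-1.
Proof.
case: a => // a _ /andP[_ /orP[] /eqP]; first by rewrite -shiftS; left.
by rewrite shiftS => /ordS_inj <-; right.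
Qed.

(** * Upper bound: lifting torus paths to windows *)

Section UpperBound.

Variables m n : nat.
Let torus := cycle_graph m.+1 □ cycle_graph n.+1.

Let unroll (k : nat) (u : torus) (q : nat * nat) : torus :=
  (shift k u.1 q.1, shift k u.2 q.2).

(** The path is lifted vertex by vertex; the two bounds leave room for all remaining steps in each
    of the four directions, and a step uses up at most one unit of it. *)
Lemma path_unroll N k u q s :
    size s <= minn q.1 q.2 -> maxn q.1 q.2 + size s < N ->
    path (@adj torus) (unroll k u q) s ->
  exists r, [/\ s = map (unroll k u) r, path (fun y z => z \in grid_nbrs y) q r
              & all (in_grid N) (q :: r)].
Proof.
elim: s q => [|v s IHs] [a b] /=.
  by exists [::]; rewrite /= /in_grid /=; split=> //; lia.
move=> le_min lt_max /andP[uv path_s].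
have [r [def_v r_nbr r_min r_max]] : exists r, [/\ v = unroll k u r,
    r \in grid_nbrs (a, b), size s <= minn r.1 r.2 & maxn r.1 r.2 + size s < N].
  case: v uv {path_s} => v1 v2 /orP[] /andP[/=].
    move=> /eqP<- /cycle_adj_shift[|->|->]; first lia.
      by exists (a, b.+1); split=> //=; try lia; apply/grid_nbrsP; constructor 2.
    exists (a, b.-1); split=> //=; try lia.
    by apply/grid_nbrsP; constructor 4; rewrite /= prednK //; lia.
  move=> + /eqP<-; move=> /cycle_adj_shift[|->|->]; first lia.
    by exists (a.+1, b); split=> //=; try lia; apply/grid_nbrsP; constructor 1.
  exists (a.-1, b); split=> //=; try lia.
  by apply/grid_nbrsP; constructor 3; rewrite /= prednK //; lia.
subst v; have [r' [-> path_r' grid_r']] := IHs r r_min r_max path_s.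
have grid_q : in_grid N (a, b) by rewrite /in_grid /=; lia.
by exists (r :: r'); split; rewrite ?[path _ _ _]/= ?r_nbr // [all _ _]/= grid_q.
Qed.

Definition torus_color (u : torus) : nat :=
  table_color (label m.+1 u.1) (label n.+1 u.2).

(** A window may wrap around a short cycle several times; consecutive labels still follow
    [label_step] across each wrap. *)
Lemma window_in_label_seqs M k (i : 'I_M.+1) : 3 <= M -> M <> 4 ->
  mkseq (fun a => label M.+1 (shift k i a)) (2 * k).+1 \in label_seqs (2 * k).
Proof.
move=> M_ge3 M_neq4; apply: mem_label_seqs; first exact: size_mkseq.
  by apply/allP=> _ /mapP[a _ ->]; apply: label_lt4.
apply/(sortedP 0) => a; rewrite size_mkseq => lt_a.
by rewrite !nth_mkseq ?(ltnW lt_a) // shiftS; apply: label_stepP => //; lia.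
Qed.

Lemma torus_colorful k t : 3 <= m -> m <> 4 -> 3 <= n -> n <> 4 ->
  windows_ok k t -> colorful torus_color k t.
Proof.
move=> m_ge3 m_neq4 n_ge3 n_neq4 ok x s size_s path_s uniq_s.
have /allP/(_ _ (window_in_label_seqs k x.2 n_ge3 n_neq4))/nilP :=
  allP ok _ (window_in_label_seqs k x.1 m_ge3 m_neq4).
rewrite ltnNge => no_path; apply/negP=> le_t.
have def_x : x = unroll k x (k, k) by rewrite /unroll /= !shift_center; case: (x).
rewrite def_x in path_s.
have [||r [def_s path_r grid_r]] := path_unroll (N := (2 * k).+1) _ _ path_s.
- by rewrite size_s /=; lia.
- by rewrite size_s /=; lia.
have size_r : size r = k by rewrite -size_s def_s size_map.
have def_xs : x :: s = map (unroll k x) ((k, k) :: r) by rewrite {1}def_x def_s.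
(* Positions with distinct images are distinct, even if the window covers some vertices
   repeatedly. *)
rewrite def_xs in le_t uniq_s; have uniq_r := map_uniq uniq_s.
(* The lift of a path with at most [t] colors would be found by a search that came out empty. *)
suff: rev ((k, k) :: r) \in few_colors_paths k t
    (mkseq (fun a => label m.+1 (shift k x.1 a)) (2 * k).+1)
    (mkseq (fun a => label n.+1 (shift k x.2 a)) (2 * k).+1).
  by rewrite no_path.
rewrite /few_colors_paths -[in X in paths_from _ _ X]size_r.
apply: mem_paths_from path_r => [y p|].
  (* Dropping a vertex cannot raise the number of colors, so the pruning is lossless. *)
  move=> /andP[/= /andP[_ ->]]; apply: leq_trans; exact: leq_ncolors_cons.
rewrite -/(rev _) rev_uniq uniq_r ncolors_rev; apply: leq_trans le_t.
rewrite -ncolors_comp; apply/eq_leq/eq_in_ncolors => q /(allP grid_r)/andP[q1 q2].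
by rewrite /= !nth_mkseq.
Qed.

Lemma torus_4_colorable : 3 <= m -> m <> 4 -> 3 <= n -> n <> 4 ->
  path_colorable 6 torus 4.
Proof.
move=> m_ge3 m_neq4 n_ge3 n_neq4.
pose f : {ffun torus -> 'I_4} := [ffun u => inord (torus_color u)].
have f_colorful k t : windows_ok k t -> colorful f k t.
  move=> /(torus_colorful m_ge3 m_neq4 n_ge3 n_neq4) col x s size_s path_s uniq_s.
  rewrite -(ncolors_inj _ _ (@ord_inj 4)) (leq_trans (col _ _ size_s path_s uniq_s)) //.
  apply/eq_leq/eq_in_ncolors => u _.
  by rewrite /= ffunE inordK // table_color_lt4.
apply/existsP; exists f; apply/path_coloringP.
by split; apply: f_colorful; [apply: windows_ok_1_1 | apply: windows_ok_5_2].
Qed.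

End UpperBound.

Theorem corollary14 (m n : nat) (hm : 4 <= m) (hn : 4 <= n)
    (hm5 : m <> 5) (hn5 : n <> 5) :
  path_chromatic 6 (cycle_graph m □ cycle_graph n) = 4.
Proof.
case: m n hm hn hm5 hn5 => [|m] [|n] // hm hn hm5 hn5.
apply/path_chromaticP=> //; split; last by move=> d; apply: torus_not_3_colorable.
by apply: torus_4_colorable; lia.
Qed.
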